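(* Let $\Sigma$ be a unimodular fan in $N_{\mathbb{R}}$. The ring homomorphism $$\varphi\colon\mathbb{Z}[x_\rho\mid\rho\in\Sigma(1)]\rightarrow\underline{\mathrm{PE}}(\Sigma),\qquad \varphi(x_\rho) = 1-[e^{\delta_\rho}]$$ induces an isomorphism $$\frac{\mathbb{Z}[x_\rho\mid\rho\in\Sigma(1)]}{\mathcal{I}+\mathcal{J}}\cong\underline{\mathrm{PE}}(\Sigma),$$ where $$\mathcal{I}=\langle x_{\rho_1}\cdots x_{\rho_k}\mid\rho_1,\dots,\rho_k\in\Sigma(1)\text{ do not lie on a common cone of }\Sigma\rangle$$ and $$\mathcal{J}=\Big\langle\prod_{\rho:\ \langle m,u_\rho\rangle>0}(1-x_\rho)^{\langle m,u_\rho\rangle}-\prod_{\rho:\ \langle m,u_\rho\rangle<0}(1-x_\rho)^{-\langle m,u_\rho\rangle}\;\Big|\; m\in M \Big\rangle .$$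
   Context: $N$ is a finitely generated free abelian group, $N_{\mathbb{R}}=\mathbb{R}\otimes_{\mathbb{Z}}N$, and $M=N^\vee=\mathrm{Hom}(N,\mathbb{Z})$, with pairing $\langle -,-\rangle$. A fan is a (finite) rational polyhedral fan; it is unimodular if each of its cones is generated by part of a $\mathbb{Z}$-basis of $N$. $\Sigma(1)$ is the set of rays of $\Sigma$, $u_\rho\in N$ is the primitive generator of the ray $\rho$, and $|\Sigma|$ is the support of $\Sigma$. A function $\ell:|\Sigma|\to\mathbb{R}$ is integral linear if $\ell=m|_{|\Sigma|}$ for some $m\in M$; the group of these is $\mathrm{L}(\Sigma)$. A function $f:|\Sigma|\to\mathbb{R}$ is integral piecewise-linear if for every $\sigma\in\Sigma$ there is $m\in M$ with $f|_\sigma=m|_\sigma$; the group of these is $\mathrm{PL}(\Sigma)$. A function $F:|\Sigma|\to\mathbb{R}$ is integral piecewise-exponential if for every $\sigma\in\Sigma$ there are $a_1,\dots,a_n\in\mathbb{Z}$ and $m_1,\dots,m_n\in M$ with $F|_\sigma=(\sum_{i=1}^n a_ie^{m_i})|_\sigma$; the ring of these (under pointwise operations) is $\mathrm{PE}(\Sigma)$. Define $\underline{\mathrm{PE}}(\Sigma)=\mathrm{PE}(\Sigma)/\langle e^\ell-1\mid \ell\in\mathrm{L}(\Sigma)\rangle$, and write $[F]$ for the class of $F\in\mathrm{PE}(\Sigma)$. For $\rho\in\Sigma(1)$, the Courant function $\delta_\rho\in\mathrm{PL}(\Sigma)$ is the unique piecewise-linear function with value $1$ at $u_\rho$ that vanishes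 on all other rays of $\Sigma$. Angle brackets around a set denote the ideal it generates. *)

(* Defs.v *)
From HB Require Import structures.
From mathcomp Require Import all_boot all_order all_algebra.
From mathcomp Require Import generic_quotient ring_quotient.
From mathcomp Require Import boolp classical_sets functions cardinality.
From mathcomp Require Import reals sequences exp.
(* The notations of mpoly clash with those of MathComp-Analysis. *)
From mathcomp Require Import -(notations) mpoly.

Set Implicit Arguments.
Unset Strict Implicit.
Unset Printing Implicit Defensive.

Import Order.TTheory GRing.Theory Num.Theory.

Local Open Scope classical_set_scope.
Local Open Scope ring_scope.

(* The quotients of ring_quotient are restricted to proper ideals and nontrivial
   rings; here the zero ring is allowed, both as ring and as quotient. *)
Record ideal (A : comPzRingType) := Ideal {
  ideal_set :> set A;
  ideal0 : ideal_set 0;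
  idealD : forall x y, ideal_set x -> ideal_set y -> ideal_set (x + y);
  idealM : forall a x, ideal_set x -> ideal_set (a * x) }.

Section IdealOperations.
Variable A : comPzRingType.

Definition span_set (S : set A) : set A :=
  [set x | exists s : seq (A * A),
     (forall ag, ag \in s -> S ag.2) /\ x = \sum_(ag <- s) ag.1 * ag.2].

Lemma span_set0 S : span_set S 0.
Proof. by exists [::]; rewrite big_nil. Qed.

Lemma span_setD S x y : span_set S x -> span_set S y -> span_set S (x + y).
Proof.
move=> [s [sS ->]] [t [tS ->]]; exists (s ++ t); rewrite big_cat; split=> // ag.
by rewrite mem_cat => /orP[/sS|/tS].
Qed.

Lemma span_setM S a x : span_set S x -> span_set S (a * x).
Proof.
move=> [s [sS ->]]; exists [seq (a * ag.1, ag.2) | ag <- s]; split.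
  by move=> ag /mapP[bg /sS ? ->].
by rewrite big_map mulr_sumr; apply: eq_bigr => ag _; rewrite mulrA.
Qed.

Definition span_ideal (S : set A) : ideal A :=
  Ideal (@span_set0 S) (@span_setD S) (@span_setM S).

Definition sum_set (I J : ideal A) : set A := [set x + y | x in I & y in J].

Lemma sum_set0 I J : sum_set I J 0.
Proof. by exists 0; [exact: ideal0|exists 0; [exact: ideal0|rewrite addr0]]. Qed.

Lemma sum_setD I J x y : sum_set I J x -> sum_set I J y -> sum_set I J (x + y).
Proof.
move=> [a Ia [b Jb <-]] [c Ic [d Jd <-]]; exists (a + c); first exact: idealD.
by exists (b + d); [exact: idealD|rewrite addrACA].
Qed.

Lemma sum_setM I J a x : sum_set I J x -> sum_set I J (a * x).
Proof.
move=> [b Ib [c Jc <-]]; exists (a * b); first exact: idealM.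
by exists (a * c); [exact: idealM|rewrite mulrDr].
Qed.

Definition sum_ideal (I J : ideal A) : ideal A :=
  Ideal (@sum_set0 I J) (@sum_setD I J) (@sum_setM I J).

End IdealOperations.

Section QuotientRing.
Variables (A : comPzRingType) (I : ideal A).

Definition ideal_pred : {pred A} := fun x => x \in (I : set A).

Lemma ideal_predP x : reflect (ideal_set I x) (x \in ideal_pred).
Proof. by apply: (iffP idP) => [/set_mem|/mem_set]. Qed.

Lemma ideal_pred_zmod : zmod_closed ideal_pred.
Proof.
split=> [|x y /ideal_predP Ix /ideal_predP Iy]; apply/ideal_predP.
  exact: ideal0.
by apply: idealD => //; rewrite -mulN1r; apply: idealM.
Qed.

HB.instance Definition _ := GRing.isZmodClosed.Build A ideal_pred ideal_pred_zmod.

Definition quot_ring := Quotient.quot ideal_pred.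
HB.instance Definition _ := GRing.Zmodule.on quot_ring.

Local Notation pi := (\pi_quot_ring)%qT.

Lemma quot_piP x y : pi x = pi y <-> ideal_set I (x - y).
Proof.
split=> [/eqP|Ixy]; first by rewrite -Quotient.idealrBE => /ideal_predP.
by apply/eqP; rewrite -Quotient.idealrBE; apply/ideal_predP.
Qed.

Definition quot_mul (a b : quot_ring) : quot_ring := pi (repr a * repr b).

Lemma quot_mulE x y : quot_mul (pi x) (pi y) = pi (x * y).
Proof.
apply/quot_piP.
have Ix : ideal_set I (repr (pi x) - x) by apply/quot_piP; rewrite reprK.
have Iy : ideal_set I (repr (pi y) - y) by apply/quot_piP; rewrite reprK.
have -> : repr (pi x) * repr (pi y) - x * y =
    repr (pi y) * (repr (pi x) - x) + x * (repr (pi y) - y).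
  by rewrite !mulrBr [_ * repr (pi x)]mulrC [_ * x]mulrC addrA subrK.
by apply: idealD; apply: idealM.
Qed.

Lemma quot_piD x y : pi (x + y) = pi x + pi y.
Proof. by rewrite !piE. Qed.

Lemma quot_mulA : associative quot_mul.
Proof.
move=> x y z; rewrite -[x]reprK -[y]reprK -[z]reprK.
by rewrite (quot_mulE (repr y) (repr z)) (quot_mulE (repr x) (repr y)) !quot_mulE
  mulrA.
Qed.

Lemma quot_mulC : commutative quot_mul.
Proof. by move=> x y; rewrite /quot_mul mulrC. Qed.

Lemma quot_mul1 : left_id (pi 1) quot_mul.
Proof. by move=> x; rewrite -{1}[x]reprK quot_mulE mul1r reprK. Qed.

Lemma quot_mulDl : left_distributive quot_mul +%R.
Proof.
move=> x y z; rewrite -[x]reprK -[y]reprK -[z]reprK.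
rewrite -quot_piD (quot_mulE (repr x) (repr z)) (quot_mulE (repr y) (repr z)).
by rewrite quot_mulE mulrDl quot_piD.
Qed.

HB.instance Definition _ := GRing.Zmodule_isComPzRing.Build quot_ring
  quot_mulA quot_mulC quot_mul1 quot_mulDl.

Definition quot_proj (x : A) : quot_ring := pi x.

Lemma quot_proj_zmod : zmod_morphism quot_proj.
Proof. by move=> x y; rewrite /quot_proj !piE. Qed.

Lemma quot_proj_monoid : monoid_morphism quot_proj.
Proof. by split=> [|x y]; rewrite /quot_proj -?quot_mulE. Qed.

HB.instance Definition _ :=
  GRing.isZmodMorphism.Build A quot_ring quot_proj quot_proj_zmod.
HB.instance Definition _ :=
  GRing.isMonoidMorphism.Build A quot_ring quot_proj quot_proj_monoid.

End QuotientRing.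

Arguments quot_proj {A} I x.

Definition zbasis (N : zmodType) (n : nat) (b : 'I_n -> N) :=
  forall v : N, exists! c : {ffun 'I_n -> int}, v = \sum_(i < n) b i *~ c i.

Definition fg_free (N : zmodType) := exists (n : nat) (b : 'I_n -> N), zbasis b.

Definition dual_lattice (N : zmodType) := {additive N -> int}.

(* The real vector space N_R = R (x)_Z N, given with u |-> 1 (x) u through the
   universal property of extension of scalars. *)
Record realification (R : realType) (N : zmodType) := Realification {
  real_space :> lmodType R;
  of_lattice : {additive N -> real_space};
  of_lattice_univ : forall (W : lmodType R) (g : {additive N -> W}),
    exists G : {linear real_space -> W},
      (forall u, G (of_lattice u) = g u) /\
      (forall G' : {linear real_space -> W},
         (forall u, G' (of_lattice u) = g u) -> G' =1 G) }.

Section Fans.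
Variables (R : realType) (N : zmodType) (NR : realification R N).
Local Notation M := (dual_lattice N).
Local Notation iota := (of_lattice NR).

Definition intr_dual (m : M) : {additive N -> R^o} :=
  (intr : {additive int -> R^o}) \o m.

(* The R-linear extension of m to N_R. *)
Definition realify (m : M) : {linear NR -> R^o} :=
  sval (cid (of_lattice_univ NR (intr_dual m))).

Lemma realifyE (m : M) (u : N) : realify m (iota u) = (m u)%:~R.
Proof. exact: (svalP (cid (of_lattice_univ NR (intr_dual m)))).1. Qed.

Lemma realify_uniq (m : M) (G : {linear NR -> R^o}) :
  (forall u, G (iota u) = (m u)%:~R) -> G =1 realify m.
Proof. exact: (svalP (cid (of_lattice_univ NR (intr_dual m)))).2. Qed.

Lemma realify0 (v : NR) : realify (\0 : M) v = 0.
Proof. by rewrite -(@realify_uniq (\0 : M) (\0 : {linear NR -> R^o})). Qed.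

Lemma realifyD (m m' : M) (v : NR) :
  realify (m \+ m' : M) v = realify m v + realify m' v.
Proof.
rewrite -(@realify_uniq (m \+ m' : M) (realify m \+ realify m')) // => u /=.
by rewrite !realifyE intrD.
Qed.

Lemma realifyB (m m' : M) (v : NR) :
  realify (m \- m' : M) v = realify m v - realify m' v.
Proof.
rewrite -(@realify_uniq (m \- m' : M) (realify m \- realify m')) // => u /=.
by rewrite !realifyE intrB.
Qed.

Definition cone (k : nat) (u : 'I_k -> N) : set NR :=
  [set v | exists c : 'I_k -> R,
     (forall i, 0 <= c i) /\ v = \sum_(i < k) c i *: iota (u i)].

Definition rational_cone (sigma : set NR) :=
  exists (k : nat) (u : 'I_k -> N), sigma = cone u.

Definition strongly_convex (sigma : set NR) :=
  forall v, sigma v -> sigma (- v) -> v = 0.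

Definition face (tau sigma : set NR) :=
  exists l : {linear NR -> R^o},
    (forall v, sigma v -> 0 <= l v) /\ tau = sigma `&` [set v | l v = 0].

Definition is_fan (Sigma : set (set NR)) :=
  [/\ finite_set Sigma,
      forall sigma, Sigma sigma -> rational_cone sigma /\ strongly_convex sigma,
      forall sigma tau, Sigma sigma -> face tau sigma -> Sigma tau &
      forall sigma tau, Sigma sigma -> Sigma tau ->
        face (sigma `&` tau) sigma /\ face (sigma `&` tau) tau].

Definition unimodular_cone (sigma : set NR) :=
  exists (n : nat) (b : 'I_n -> N) (k : nat) (f : 'I_k -> 'I_n),
    [/\ zbasis b, injective f & sigma = cone (b \o f)].

Definition unimodular (Sigma : set (set NR)) :=
  forall sigma, Sigma sigma -> unimodular_cone sigma.

Definition dim1 (sigma : set NR) :=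
  exists v, [/\ v != 0, sigma v & forall w, sigma w -> exists c : R, w = c *: v].

Definition rays (Sigma : set (set NR)) : set (set NR) :=
  [set rho | Sigma rho /\ dim1 rho].

Definition primitive_generator (rho : set NR) (u : N) :=
  forall w : N, rho (iota w) <-> exists j : nat, w = u *+ j.

(* The generator u_rho; the default 0 is never used on a ray. *)
Definition ray_gen (rho : set NR) : N := xget 0 (primitive_generator rho).

Definition fan_support (Sigma : set (set NR)) : set NR :=
  \bigcup_(sigma in Sigma) sigma.

Section Functions.
Variable Sigma : set (set NR).
Local Notation supp := (set_type (fan_support Sigma)).

Definition is_linear_on (f : supp -> R) :=
  exists m : M, forall v, f v = realify m (val v).

Definition is_PL (f : supp -> R) :=
  forall sigma, Sigma sigma ->
    exists m : M, forall v, sigma (val v) -> f v = realify m (val v).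

(* On each cone, the sum of a * e^m over a list of pairs (a, m). *)
Definition is_PE (F : supp -> R) :=
  forall sigma, Sigma sigma ->
    exists s : seq (int * M), forall v, sigma (val v) ->
      F v = \sum_(am <- s) am.1%:~R * expR (realify am.2 (val v)).

Definition PL_pred : {pred supp -> R} := fun f => `[< is_PL f >].
Definition PE_pred : {pred supp -> R} := fun F => `[< is_PE F >].

Lemma PL_zmod_closed : zmod_closed PL_pred.
Proof.
split=> [|f g /asboolP fPL /asboolP gPL]; apply/asboolP => sigma sS.
  by exists (\0 : M) => v _; rewrite realify0.
have [m fm] := fPL _ sS; have [m' gm] := gPL _ sS.
by exists (m \- m' : M) => v sv; rewrite realifyB -fm -?gm.
Qed.

HB.instance Definition _ :=
  GRing.isZmodClosed.Build (supp -> R) PL_pred PL_zmod_closed.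

Lemma PE_subring_closed : subring_closed PE_pred.
Proof.
split=> [|F G /asboolP FPE /asboolP GPE|F G /asboolP FPE /asboolP GPE];
  apply/asboolP => sigma sS.
- by exists [:: (1, \0 : M)] => v _; rewrite big_seq1 mul1r realify0 expR0.
- have [s Fs] := FPE _ sS; have [t Gt] := GPE _ sS.
  exists (s ++ [seq (- am.1, am.2) | am <- t]) => v sv.
  rewrite big_cat big_map /= -Fs // -[LHS]/(F v - G v) (Gt v sv) -sumrN.
  by congr (_ + _); apply: eq_bigr => am _; rewrite intrN mulNr.
- have [s Fs] := FPE _ sS; have [t Gt] := GPE _ sS.
  exists [seq (am.1 * bn.1, am.2 \+ bn.2 : M) |
          am : int * M <- s, bn : int * M <- t] => v sv.
  rewrite big_allpairs_dep -[LHS]/(F v * G v) (Fs v sv) (Gt v sv) mulr_suml.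
  apply: eq_bigr => am _; rewrite mulr_sumr; apply: eq_bigr => bn _ /=.
  by rewrite realifyD expRD intrM mulrACA.
Qed.

HB.instance Definition _ :=
  GRing.isSubringClosed.Build (supp -> R) PE_pred PE_subring_closed.

Record PL := MkPL { PL_fun :> supp -> R; PL_mem : PL_fun \in PL_pred }.

HB.instance Definition _ := [isSub for PL_fun].
HB.instance Definition _ := [Choice of PL by <:].
HB.instance Definition _ := [SubChoice_isSubZmodule of PL by <:].

Record PE := MkPE { PE_fun :> supp -> R; PE_mem : PE_fun \in PE_pred }.

HB.instance Definition _ := [isSub for PE_fun].
HB.instance Definition _ := [Choice of PE by <:].
HB.instance Definition _ := 
  GRing.SubChoice_isSubComPzRing.Build (supp -> R) PE_pred PE PE_subring_closed.

Lemma exp_PL_mem (f : PL) : (fun v => expR (f v)) \in PE_pred.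
Proof.
apply/asboolP => sigma sS; have /asboolP/(_ _ sS)[m fm] := PL_mem f.
by exists [:: (1, m)] => v sv; rewrite big_seq1 mul1r fm.
Qed.

Definition exp_PL (f : PL) : PE := MkPE (exp_PL_mem f).

Definition linear_ideal : ideal PE :=
  span_ideal [set exp_PL l - 1 | l in [set l : PL | is_linear_on l]].

Definition uPE := quot_ring linear_ideal.
HB.instance Definition _ := GRing.ComPzRing.on uPE.

Definition uPE_class (F : PE) : uPE := quot_proj linear_ideal F.

Definition is_courant (rho : set NR) (d : PL) :=
  (forall v, val v = iota (ray_gen rho) -> d v = 1) /\
  (forall rho', rays Sigma rho' -> rho' <> rho ->
     forall v, rho' (val v) -> d v = 0).

(* The Courant function; on a ray of a unimodular fan it exists and is unique. *)
Definition courant (rho : set NR) : PL := xget 0 (is_courant rho).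

(* Z[x_rho], with rho : 'I_k -> set NR an enumeration of the rays. *)
Variables (k : nat) (rho : 'I_k -> set NR).
Local Notation Zx := (mpoly k int).

Definition xvar (i : 'I_k) : Zx := mpolyX int (mnm1 i).

Definition stanley_reisner_ideal : ideal Zx :=
  span_ideal [set \prod_(i <- s) xvar i | s in
    [set s : seq 'I_k | ~ exists2 sigma, Sigma sigma &
                          forall i, i \in s -> rho i `<=` sigma]].

Definition mult_linear_ideal : ideal Zx :=
  span_ideal [set
      \prod_(i < k | 0 < m (ray_gen (rho i))) (1 - xvar i) ^+ `|m (ray_gen (rho i))|%N
    - \prod_(i < k | m (ray_gen (rho i)) < 0) (1 - xvar i) ^+ `|m (ray_gen (rho i))|%N
    | m in [set: M]].

End Functions.
End Fans.

(* Main.v *)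
Require Import Defs.
From HB Require Import structures.
From mathcomp Require Import all_boot all_order all_algebra.
From mathcomp Require Import boolp classical_sets functions cardinality.
From mathcomp Require Import reals sequences exp.
From mathcomp Require Import -(notations) mpoly.
From mathcomp Require Import ring_quotient generic_quotient.
From mathcomp Require Import ring.

Set Implicit Arguments.
Unset Strict Implicit.
Unset Printing Implicit Defensive.

Import Order.TTheory GRing.Theory Num.Theory.

Local Open Scope classical_set_scope.
Local Open Scope ring_scope.

(* Phi : Z[x_rho] -> PE sends x_rho to 1 - e^(delta_rho).  Its kernel is I: on a
   cone sigma the delta_rho with rho in sigma are independent coordinates and
   the others vanish, so a polynomial in the x_rho with rho in sigma that
   vanishes on sigma is zero.  Every F in PE becomes an element of the image of
   Phi after multiplication by some product of the 1 - x_rho: for the pullback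
   of F along the retraction onto a cone this is clear, and subtracting such
   pullbacks cone by cone leaves 0.  The generators of J correspond to e^l - 1
   up to such products.  Finally each x_rho is nilpotent modulo I + J, so the
   1 - x_rho are units there and all these denominators can be cleared. *)

(** * Ideals, kernels and quotient rings *)

Lemma span_ideal_sub (A : comPzRingType) (S : set A) (I : ideal A) :
  S `<=` I -> span_ideal S `<=` I.
Proof.
move=> SI _ [s [sS ->]]; rewrite big_seq; elim/big_ind: _ => [|x y|ag /sS/SI Ig].
- exact: ideal0.
- exact: idealD.
- exact: idealM.
Qed.

Lemma quot_proj_eq0 (A : comPzRingType) (I : ideal A) x :
  quot_proj I x = 0 <-> ideal_set I x.
Proof. by rewrite -(rmorph0 (quot_proj I)) /quot_proj quot_piP subr0. Qed.

Section Kernel.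
Variables (A B : comPzRingType) (f : {rmorphism A -> B}).

Lemma ker_idealD x y : f x = 0 -> f y = 0 -> f (x + y) = 0.
Proof. by move=> fx fy; rewrite rmorphD fx fy addr0. Qed.

Lemma ker_idealM a x : f x = 0 -> f (a * x) = 0.
Proof. by move=> fx; rewrite rmorphM fx mulr0. Qed.

Definition ker_ideal : ideal A :=
  @Ideal A [set x | f x = 0] (rmorph0 f) ker_idealD ker_idealM.

End Kernel.

(** First isomorphism theorem: [psi] applies [f] to a representative, and two representatives differ
    by an element of the kernel. *)
Lemma quot_ring_iso (A B : comPzRingType) (I : ideal A) (f : {rmorphism A -> B}) :
    (forall x, f x = 0 <-> ideal_set I x) -> (forall y, exists x, f x = y) ->
  exists psi : {rmorphism quot_ring I -> B},
    bijective psi /\ forall x, psi (quot_proj I x) = f x.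
Proof.
move=> kerf surjf.
pose psi (a : quot_ring I) := f (repr a).
have psiE x : psi (quot_proj I x) = f x.
  apply/eqP; rewrite -subr_eq0 -rmorphB; apply/eqP/kerf.
  by apply/quot_piP; rewrite reprK.
have projK a : quot_proj I (repr a) = a by rewrite /quot_proj reprK.
have psiB : zmod_morphism psi.
  by move=> a b; rewrite -[a]projK -[b]projK -rmorphB !psiE rmorphB.
have psiM : monoid_morphism psi.
  split=> [|a b]; first by rewrite -(rmorph1 (quot_proj I)) psiE rmorph1.
  by rewrite -[a]projK -[b]projK -rmorphM !psiE rmorphM.
pose psi_morph : {rmorphism quot_ring I -> B} := HB.pack psi
  (GRing.isZmodMorphism.Build _ _ psi psiB)
  (GRing.isMonoidMorphism.Build _ _ psi psiM).
exists psi_morph; split=> //=.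
pose g y := quot_proj I (sval (cid (surjf y))).
have gK : cancel g psi by move=> y; rewrite /g psiE; exact: (svalP (cid (surjf y))).
exists g => // a; rewrite -[RHS]projK; apply/quot_piP/kerf.
by apply/eqP; rewrite rmorphB subr_eq0; apply/eqP; rewrite (svalP (cid (surjf _))).
Qed.

(** * Nilpotent elements *)

Section Nilpotents.
Variable A : comPzRingType.

Definition is_nilpotent (x : A) := exists n, x ^+ n = 0.

Lemma is_nilpotent0 : is_nilpotent 0.
Proof. by exists 1%N. Qed.

Lemma is_nilpotentM x y : is_nilpotent y -> is_nilpotent (x * y).
Proof. by move=> [n yn]; exists n; rewrite exprMn yn mulr0. Qed.

Lemma is_nilpotentD x y : is_nilpotent x -> is_nilpotent y -> is_nilpotent (x + y).
Proof.
move=> [m xm] [n yn]; exists (m + n)%N; rewrite exprDn big1 // => i _.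
have [/subnK <-|/ltnW lt_in] := leqP n i.
  by rewrite exprD yn mulr0 mulr0 mul0rn.
by rewrite -addnBA // exprD xm mul0r mul0r mul0rn.
Qed.

Lemma is_nilpotentX x n : is_nilpotent (x ^+ n) -> is_nilpotent x.
Proof. by move=> [m xnm]; exists (n * m)%N; rewrite exprM. Qed.

Lemma is_nilpotentB1_unit x : is_nilpotent x -> exists y, (1 - x) * y = 1.
Proof.
move=> [n xn]; exists (\sum_(i < n) x ^+ i).
by rewrite -opprB mulNr -subrX1 xn sub0r opprK.
Qed.

(* Descending induction on S shows that x_S is nilpotent for every nonempty S:
   modulo the x_T with T larger than S, multiplying the relation at i by x_S
   leaves x_S (1 - x_i) = x_S, so x_S ^ 2 is a multiple of x_S x_i = 0. *)
Lemma nilpotent_face_ring k (x : 'I_k -> A) (face : {set 'I_k} -> Prop) :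
    (forall S, ~ face S -> \prod_(i in S) x i = 0) ->
    (forall (S : {set 'I_k}) i, face S -> i \in S -> exists e : 'I_k -> int,
       [/\ e i = 1, forall j, j \in S -> j != i -> e j = 0 &
           \prod_(j < k | 0 < e j) (1 - x j) ^+ `|e j|%N =
           \prod_(j < k | e j < 0) (1 - x j) ^+ `|e j|%N]) ->
  forall i, is_nilpotent (x i).
Proof.
move=> nonface faceP i.
suff nilS n : forall S : {set 'I_k}, (k - #|S| < n)%N -> S != finset.set0 ->
    is_nilpotent (\prod_(j in S) x j).
  have := nilS k.+1 [set i]%SET; rewrite big_set1; apply.
    by rewrite ltnS leq_subr.
  by apply/set0Pn; exists i; rewrite inE.
elim: n => // n IHn S Sn /set0Pn[j jS].
have [faceS|/nonface->] := pselect (face S); last exact: is_nilpotent0.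
have [e [ej eS eq_e]] := faceP _ _ faceS jS.
set xS := \prod_(_ in _) _.
have nilxS l : l \notin S -> is_nilpotent (xS * x l).
  move=> lS; rewrite mulrC /xS -big_setU1 //=; apply: IHn.
    rewrite finset.cardsU1 lS add1n subnSK // -[X in (_ < X)%N]card_ord -cardsT.
    by rewrite proper_card // properT; apply: contraNneq lS => ->; rewrite inE.
  by apply/set0Pn; exists l; rewrite !inE eqxx.
(* Factors 1 - x_l with l outside S equal 1 up to terms that become nilpotent once multiplied by
   x_S. *)
have nil1 (P : pred 'I_k) : (forall l, P l -> l \notin S) ->
    is_nilpotent (xS * (\prod_(l < k | P l) (1 - x l) ^+ `|e l|%N - 1)).
  move=> PS; apply: (big_ind (fun a => is_nilpotent (xS * (a - 1)))).
  - by rewrite subrr mulr0; exact: is_nilpotent0.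
  - move=> a b na nb; have -> : xS * (a * b - 1) = b * (xS * (a - 1)) + xS * (b - 1).
      by ring.
    by apply: is_nilpotentD => //; apply: is_nilpotentM.
  - move=> l /PS lS; elim: `|e l|%N => [|m IHm].
      by rewrite expr0 subrr mulr0; exact: is_nilpotent0.
    have -> : xS * ((1 - x l) ^+ m.+1 - 1) =
        xS * ((1 - x l) ^+ m - 1) + (- (1 - x l) ^+ m) * (xS * x l).
      by rewrite exprS; ring.
    by apply: is_nilpotentD => //; apply: is_nilpotentM; apply: nilxS.
apply: (@is_nilpotentX _ 2).
have -> : xS ^+ 2 = (\prod_(l in S :\ j) x l) * (xS * x j).
  by rewrite expr2 {1}/xS (big_setD1 j) //=; ring.
apply: is_nilpotentM.
move: eq_e; rewrite (bigD1 j) ?ej //= expr1 => eq_e.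
have notS l : e l != 0 -> l != j -> l \notin S.
  by move=> el lj; apply: contra el => lS; rewrite (eS l).
set a := \prod_(_ < _ | _) _ in eq_e; set b := \prod_(_ < _ | _) _ in eq_e.
(* Here [eq_e] reads (1 - x_j) a = b, so x_j = (1 - x_j)(a - 1) - (b - 1). *)
have -> : xS * x j = (1 - x j) * (xS * (a - 1)) + -1 * (xS * (b - 1)).
  by rewrite -eq_e; ring.
apply: is_nilpotentD; apply: is_nilpotentM; apply: nil1 => l.
  by move=> /andP[el lj]; apply: notS => //; rewrite gt_eqF.
by move=> el; apply: notS; [rewrite lt_eqF|apply: contraTneq el => ->; rewrite ej].
Qed.

End Nilpotents.

(** * Integer polynomials determined by their values *)

Lemma digits_inj (d n : nat) (a b : 'I_n -> nat) :
    (forall i, a i < d)%N -> (forall i, b i < d)%N ->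
  (\sum_(i < n) a i * d ^ i = \sum_(i < n) b i * d ^ i)%N -> a =1 b.
Proof.
elim: n a b => [|n IHn] a b ad bd; first by move=> _ [].
have shift (c : 'I_n.+1 -> nat) : (\sum_(i < n.+1) c i * d ^ i =
    (\sum_(i < n) c (lift ord0 i) * d ^ i) * d + c ord0)%N.
  rewrite big_ord_recl expn0 muln1 addnC big_distrl; congr (_ + _)%N.
  by apply: eq_bigr => i _; rewrite /= expnS mulnCA mulnC.
rewrite !shift => eq_ab; have d0 : (0 < d)%N by apply: leq_trans (ad ord0).
(* The lowest digit is the residue modulo [d]; cancelling it and dividing by [d] leaves the
   remaining digits to the induction. *)
have eq0 : a ord0 = b ord0.
  by move: (congr1 (modn^~ d) eq_ab); rewrite !modnMDl !modn_small.
move: eq_ab; rewrite eq0 => /addIn/eqP; rewrite eqn_pmul2r // => /eqP/IHn eqS i.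
by case: (unliftP ord0 i) => [j|] -> //; apply: eqS.
Qed.

(* Kronecker substitution 'X_i := - z ^ (d ^ i), with d larger than all the
   exponents of p, reduces to univariate polynomials. *)
Lemma mpoly_vanish_npos (R : realFieldType) k (p : mpoly k int) :
  (forall x : 'I_k -> R, (forall i, x i <= 0) -> mmap intr x p = 0) -> p = 0.
Proof.
move=> p0; pose d := msize p.
pose x := fun i : 'I_k => - 'X^(d ^ i) : {poly R}.
pose deg (m : multinom k) := (\sum_(i < k) m i * d ^ i)%N.
have monE m : mmap1 x m = (-1) ^+ mdeg m *: 'X^(deg m).
  rewrite /mmap1 /deg mdegE -!prodrXr -mul_polyC rmorph_prod -big_split /=.
  apply: eq_bigr => i _; rewrite /x [LHS]exprNn -exprM mulnC.
  by rewrite rmorphXn rmorphN1.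
pose q : {poly R} := \sum_(m <- msupp p) ((mcoeff m p)%:~R * (-1) ^+ mdeg m) *: 'X^(deg m).
have qz z : 0 <= z -> q.[z] = 0.
  move=> z0; rewrite -[RHS](p0 (fun i => - z ^+ (d ^ i))) => [|i]; last first.
    by rewrite oppr_le0 exprn_ge0.
  rewrite horner_sum; apply: eq_bigr => m _.
  rewrite hornerZ hornerXn -mulrA; congr (_ * _).
  have -> : (-1) ^+ mdeg m * z ^+ deg m = (mmap1 x m).[z].
    by rewrite monE hornerZ hornerXn.
  rewrite /mmap1 horner_prod; apply: eq_bigr => i _.
  by rewrite horner_exp hornerN hornerXn.
have q0 : q = 0.
  (* The [size q] points 0, 1, 2, ... are all roots, too many for a nonzero polynomial of this
     size. *)
  apply/eqP; apply: contraT => qN0.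
  have := @max_poly_roots _ q [seq i%:R | i <- iota 0 (size q)] qN0.
  rewrite size_map size_iota ltnn; apply.
    by apply/allP => _ /mapP[i _ ->]; apply/rootP; rewrite qz ?ler0n.
  by rewrite map_inj_uniq ?iota_uniq // => i j /eqP; rewrite eqr_nat => /eqP.
(* A monomial [m] of [p] would contribute its coefficient, up to sign, to [q] in degree [deg m]; by
   [digits_inj] no other monomial of [p] has that degree. *)
apply: msuppnil0; case E: (msupp p) => [//|m s].
have mp : m \in msupp p by rewrite E mem_head.
have exp_lt m' : m' \in msupp p -> forall i, (m' i < d)%N.
  move=> /msize_mdeg_lt lt_m i; apply: leq_ltn_trans lt_m.
  by rewrite mdegE (bigD1 i) //= leq_addr.
have : q`_(deg m) = 0 by rewrite q0 coef0.
rewrite coef_sum (bigD1_seq m) ?msupp_uniq //= big_seq_cond big1 => [|m' /andP[m'p]].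
  rewrite addr0 coefZ coefXn eqxx mulr1 => /eqP.
  rewrite mulf_eq0 signr_eq0 orbF intr_eq0 => /eqP cm.
  by move: mp; rewrite mcoeff_msupp cm eqxx.
move=> m'm; rewrite coefZ coefXn; case: eqP => [eq_deg|_]; last by rewrite mulr0.
have /mnmP eq_m := digits_inj (exp_lt _ mp) (exp_lt _ m'p) eq_deg.
by rewrite eq_m eqxx in m'm.
Qed.

(** * Cones and dual bases *)

(** The dual basis consists of the coordinate functions, additive because coordinates are unique. *)
Lemma zbasis_dual (N : zmodType) n (b : 'I_n -> N) : zbasis b ->
  exists m : 'I_n -> dual_lattice N,
    (forall i j, m i (b j) = (i == j)%:R) /\ forall v, v = \sum_i b i *~ m i v.
Proof.
move=> hb; pose c v := sval (cid (hb v)).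
have cE v : v = \sum_i b i *~ c v i by have [] := svalP (cid (hb v)).
have c_uniq v (d : {ffun 'I_n -> int}) : v = \sum_i b i *~ d i -> c v = d.
  by have [_] := svalP (cid (hb v)); apply.
have cB i : zmod_morphism (fun v => c v i).
  move=> v w; rewrite (c_uniq (v - w) [ffun l => c v l - c w l]) ?ffunE //.
  rewrite [in LHS](cE v) [in LHS](cE w) -sumrB.
  by apply: eq_bigr => l _; rewrite ffunE mulrzBr.
pose m i : dual_lattice N :=
  HB.pack (fun v => c v i) (GRing.isZmodMorphism.Build _ _ _ (cB i)).
exists m; split=> [i j|v]; last exact: cE.
rewrite /m /= (c_uniq _ [ffun l => (l == j)%:R]) ?ffunE //.
rewrite (bigD1 j) //= ffunE eqxx mulr1z big1 ?addr0 // => l /negPf lj.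
by rewrite ffunE lj mulr0z.
Qed.

Section Cones.
Variables (R : realType) (N : zmodType) (NR : realification R N).
Local Notation M := (dual_lattice N).
Local Notation iota := (of_lattice NR).
Local Notation ev := (realify NR).
Local Notation cone := (@cone R N NR _).

Lemma realifyZ m (a : R) v : ev m (a *: v) = a * ev m v.
Proof. by rewrite linearZ. Qed.

Definition half_line (u : N) : set NR := [set v | exists2 c : R, 0 <= c & v = c *: iota u].

Lemma coneD n (w : 'I_n -> N) x y : cone w x -> cone w y -> cone w (x + y).
Proof.
move=> [c [c0 ->]] [d [d0 ->]]; exists (fun i => c i + d i); split=> [i|].
  by rewrite addr_ge0.
by rewrite -big_split; apply: eq_bigr => i _; rewrite scalerDl.
Qed.

Lemma coneZ n (w : 'I_n -> N) a x : 0 <= a -> cone w x -> cone w (a *: x).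
Proof.
move=> a0 [c [c0 ->]]; exists (fun i => a * c i); split=> [i|].
  by rewrite mulr_ge0.
by rewrite scaler_sumr; apply: eq_bigr => i _; rewrite scalerA.
Qed.

Lemma cone0 n (w : 'I_n -> N) : cone w 0.
Proof. by exists (fun=> 0); split=> //; rewrite big1 // => i _; rewrite scale0r. Qed.

Lemma cone_gen n (w : 'I_n -> N) i : cone w (iota (w i)).
Proof.
exists (fun j => (j == i)%:R); split=> [j|]; first by rewrite ler0n.
by rewrite (bigD1 i) //= eqxx scale1r big1 ?addr0 // => j /negPf->; rewrite scale0r.
Qed.

Lemma half_line_cone n (w : 'I_n -> N) j : half_line (w j) `<=` cone w.
Proof. by move=> _ [c c0 ->]; apply/coneZ/cone_gen. Qed.

Lemma half_line_gen u : half_line u (iota u).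
Proof. by exists 1; rewrite ?scale1r. Qed.

Section DualFamily.
Variables (n : nat) (w : 'I_n -> N) (m : 'I_n -> M).
Hypothesis mw : forall i j, m i (w j) = (i == j)%:R.

Lemma realify_dual (c : 'I_n -> R) i : ev (m i) (\sum_j c j *: iota (w j)) = c i.
Proof.
rewrite linear_sum (bigD1 i) //= realifyZ realifyE mw eqxx big1 => [|j /negPf ji].
  by rewrite addr0 mulr1.
by rewrite realifyZ realifyE mw eq_sym ji mulr0.
Qed.

Lemma dual_neq0 i : iota (w i) != 0.
Proof.
apply/eqP => w0; have /eqP := realifyE NR (m i) (w i).
by rewrite w0 linear0 mw eqxx eq_sym oner_eq0.
Qed.

Lemma half_line_dim1 i : dim1 (half_line (w i)).
Proof.
exists (iota (w i)); split; [exact: dual_neq0|exact: half_line_gen|].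
by move=> _ [c _ ->]; exists c.
Qed.

(** The supporting functional is the sum of the dual coordinates other than the j-th: on the cone it
    vanishes only where each of them does. *)
Lemma half_line_face j : face (half_line (w j)) (cone w).
Proof.
pose l := fun v => \sum_(i < n | i != j) ev (m i) v : R^o.
have l_lin : linear l.
  move=> a x y; rewrite /l scaler_sumr -big_split; apply: eq_bigr => i _.
  by rewrite linearP.
pose L : {linear NR -> R^o} := HB.pack l (GRing.isLinear.Build _ _ _ _ l l_lin).
exists L; split=> [_ [c [c0 ->]]|]; first by apply: sumr_ge0 => i _; rewrite realify_dual.
apply/seteqP; split=> [v vj|_ [[c [c0 ->]] /= /eqP]].
  split; first exact: half_line_cone vj.
  move: vj => [c _ ->]; rewrite /= /l big1 // => i /negPf ij.
  by rewrite realifyZ realifyE mw ij mulr0.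
rewrite psumr_eq0 => [/allP lc0|i _]; last by rewrite realify_dual.
exists (c j) => //; rewrite (bigD1 j) //= big1 ?addr0 // => i ij.
have := lc0 i; rewrite mem_index_enum ij realify_dual => /(_ isT)/eqP->.
by rewrite scale0r.
Qed.

(** If a functional is nonnegative on the cone and kills a nonzero point of it, then it kills every
    generator occurring in that point; such a generator spans the one-dimensional face. *)
Lemma face_dim1 tau : face tau (cone w) -> dim1 tau -> exists j, tau = half_line (w j).
Proof.
move=> [l [l0 ->]] [v [v0 [[c [c0 vE]] /= /eqP lv] tauv]].
move: lv; rewrite vE linear_sum psumr_eq0 => [/allP lv|i _]; last first.
  by rewrite linearZ mulr_ge0 // l0 //; apply: cone_gen.
have [j cj] : exists j, c j != 0.
  apply: contrapT => /forallNP cN; move: v0; rewrite vE big1 ?eqxx // => i _.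
  by have /negP/negPn/eqP-> := cN i; rewrite scale0r.
have lj : l (iota (w j)) = 0.
  have := lv j; rewrite mem_index_enum linearZ /= mulf_eq0 (negPf cj).
  by move=> /(_ isT)/eqP.
exists j; apply/seteqP; split=> [x taux|_ [a a0 ->]]; last first.
  split; first by apply/coneZ/cone_gen.
  by rewrite /= linearZ /= lj scaler0.
have [a xE] := tauv _ taux.
have [d dE] := tauv (iota (w j)) (conj (cone_gen w j) lj).
have d0 : d != 0.
  by apply: contraTneq (dual_neq0 j) => d0; rewrite dE d0 scale0r eqxx.
have xj : x = (a / d) *: iota (w j) by rewrite dE scalerA divfK.
(* The factor [a / d] is nonnegative, being the j-th dual coordinate of the point [x] of the
   cone. *)
exists (a / d) => //; case: taux => [[e [e0 xe]] _].
have := realify_dual e j; rewrite -xe xj realifyZ realifyE mw eqxx.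
by rewrite mulr1 => ->.
Qed.

End DualFamily.

(** A lattice point on the half-line has integer dual coordinates, all zero except the i-th, which
    is nonnegative. *)
Lemma half_line_primitive n (b : 'I_n -> N) i : zbasis b ->
  primitive_generator (half_line (b i)) (b i).
Proof.
move=> /zbasis_dual[m [mb bE]] w; split=> [[c c0 wE]|[j ->]]; last first.
  by exists j%:R; rewrite ?ler0n // raddfMn scaler_nat.
have mw l : (m l w)%:~R = c * (l == i)%:R.
  by rewrite -(realifyE NR) wE realifyZ realifyE mb; case: (l == i).
exists `|m i w|%N; rewrite {1}[w]bE (bigD1 i) //= big1 ?addr0 => [|l /negPf li].
  rewrite pmulrn gez0_abs //; move: (mw i); rewrite eqxx mulr1.
  by rewrite -(ler0z R) => ->.
by move: (mw l); rewrite li mulr0 => /eqP; rewrite intr_eq0 => /eqP->; rewrite mulr0z.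
Qed.

(** Two primitive generators are natural multiples of each other; the dual functional shows that the
    two factors have product 1. *)
Lemma ray_gen_half_line n (b : 'I_n -> N) i : zbasis b ->
  ray_gen (half_line (b i)) = b i.
Proof.
move=> hb; have prim := half_line_primitive i hb.
have prim' : primitive_generator (half_line (b i)) (ray_gen (half_line (b i))).
  exact: xgetPex (ex_intro _ _ prim).
set u := ray_gen _ in prim' *.
have [j uE] : exists j, u = b i *+ j by apply/prim/prim'; exists 1%N.
have [l bE] : exists l, b i = u *+ l by apply/prim'/prim; exists 1%N.
have [m [mb _]] := zbasis_dual hb.
have /eqP := congr1 (m i) bE; rewrite uE !raddfMn /= mb eqxx -mulrnA.
rewrite eqr_nat eq_sym muln_eq1 => /andP[/eqP-> _].
by rewrite mulr1n.
Qed.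

End Cones.

(** * Evaluation at points of the support *)

Section Evaluation.
Variables (R : realType) (N : zmodType) (NR : realification R N).
Variable Sigma : set (set NR).
Local Notation supp := (set_type (fan_support Sigma)).

Definition PL_eval (v : supp) (f : PL Sigma) : R := f v.
Definition PE_eval (v : supp) (F : PE Sigma) : R := F v.

Lemma PL_eval_zmod v : zmod_morphism (PL_eval v). Proof. by []. Qed.
Lemma PE_eval_zmod v : zmod_morphism (PE_eval v). Proof. by []. Qed.
Lemma PE_eval_monoid v : monoid_morphism (PE_eval v). Proof. by []. Qed.

HB.instance Definition _ v :=
  GRing.isZmodMorphism.Build (PL Sigma) R (PL_eval v) (PL_eval_zmod v).
HB.instance Definition _ v :=
  GRing.isZmodMorphism.Build (PE Sigma) R (PE_eval v) (PE_eval_zmod v).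
HB.instance Definition _ v :=
  GRing.isMonoidMorphism.Build (PE Sigma) R (PE_eval v) (PE_eval_monoid v).

Lemma PE_ext (F G : PE Sigma) : (forall v, PE_eval v F = PE_eval v G) -> F = G.
Proof. by move=> FG; apply/val_inj/funext. Qed.

End Evaluation.

Arguments PL_eval : simpl never.
Arguments PE_eval : simpl never.

(** * Coordinates on a unimodular fan *)

Section UnimodularFan.
Variables (R : realType) (N : zmodType) (NR : realification R N).
Variable Sigma : set (set NR).
Hypotheses (hfan : is_fan Sigma) (huni : unimodular Sigma).
Variables (k : nat) (rho : 'I_k -> set NR).
Hypothesis hrho : set_bij [set: 'I_k] (rays Sigma) rho.
Local Notation M := (dual_lattice N).
Local Notation iota := (of_lattice NR).
Local Notation ev := (realify NR).
Local Notation cone := (@cone R N NR _).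
Local Notation half_line := (@half_line R N NR).
Local Notation u i := (ray_gen (rho i)).
Local Notation supp := (set_type (fan_support Sigma)).

(** Here [g] lists the rays inside [sigma]. Each basis vector of [sigma] spans a face, hence a ray
    of the fan. Conversely a ray inside [sigma] is its own intersection with [sigma], so it is a
    face and is spanned by a basis vector. *)
Lemma fan_cone sigma : Sigma sigma ->
  exists n (g : 'I_n -> 'I_k) (m : 'I_n -> M),
    [/\ sigma = cone (fun j => u (g j)),
        forall i j, m i (u (g j)) = (i == j)%:R &
        forall i, rho i `<=` sigma <-> exists j, g j = i].
Proof.
move=> sS; have [n [b [n' [f [hb f_inj sE]]]]] := huni sS.
have [_ _ faceS faceI] := hfan; have [rhoS rho_inj rho_surj] := hrho.
have [mb [mbE _]] := zbasis_dual hb.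
pose m j := mb (f j).
have mw i j : m i ((b \o f) j) = (i == j)%:R by rewrite mbE (inj_eq f_inj).
have ray_w j : rays Sigma (half_line (b (f j))).
  split; last exact: (half_line_dim1 NR mw j).
  by apply: faceS sS _; rewrite sE; exact: (half_line_face NR mw j).
have gP j : exists i, rho i = half_line (b (f j)).
  by have [i _ <-] := rho_surj _ (ray_w j); exists i.
pose g j := sval (cid (gP j)).
have gE j : rho (g j) = half_line (b (f j)) := svalP (cid (gP j)).
have uE j : u (g j) = b (f j) by rewrite gE ray_gen_half_line.
exists n', g, m; split=> [|i j|i].
- by rewrite sE; congr Defs.cone; apply/funext => j; rewrite uE.
- by rewrite uE mw.
split=> [rho_s|[j <-]]; last first.
  by rewrite gE sE; exact: (@half_line_cone _ _ _ _ (b \o f)).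
have [Srho dim_rho] := rhoS i Logic.I.
have [_] := faceI _ _ Srho sS; rewrite (setIidl rho_s) sE => face_rho.
have [j rhoE] := face_dim1 mw face_rho dim_rho.
by exists j; apply: rho_inj; rewrite ?in_setT // gE.
Qed.

(** Indexing by all rays of the fan gives every cone the same coordinate system. *)
Lemma mem_cone_rays sigma v : Sigma sigma ->
  sigma v <-> exists c : 'I_k -> R, [/\ forall i, 0 <= c i,
    forall i, c i != 0 -> rho i `<=` sigma & v = \sum_i c i *: iota (u i)].
Proof.
move=> sS; have [n [g [m [sE _ gP]]]] := fan_cone sS.
split=> [|[c [c0 cs ->]]].
  rewrite [in X in X -> _]sE => -[c [c0 ->]].
  (* Summing over the fibres of [g] avoids an appeal to its injectivity. *)
  exists (fun i => \sum_(j | g j == i) c j); split=> [i|i|].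
  - exact: sumr_ge0.
  - move=> ci; apply/gP; apply: contrapT => /forallNP gN.
    by move: ci; rewrite big1 ?eqxx // => j /eqP /gN.
  - rewrite (partition_big g xpredT) //=; apply: eq_bigr => i _.
    by rewrite scaler_suml; apply: eq_bigr => j /eqP->.
rewrite sE; elim/big_ind: _ => [|x y|i _]; [exact: cone0|exact: coneD|].
have [->|/cs/gP[j <-]] := eqVneq (c i) 0; first by rewrite scale0r; exact: cone0.
by apply: coneZ => //; exact: (cone_gen _ (fun j => u (g j))).
Qed.

Lemma dual_gen sigma i : Sigma sigma -> rho i `<=` sigma ->
  exists m : M, forall j, rho j `<=` sigma -> m (u j) = (j == i)%:R.
Proof.
move=> sS; have [n [g [m [_ mg gP]]]] := fan_cone sS.
move=> /gP[l <-]; exists (m l) => _ /gP[j <-]; rewrite mg.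
have [->|jl] := eqVneq l j; first by rewrite eqxx.
case: eqP => // eq_g; have := mg l j; rewrite eq_g mg eqxx (negPf jl).
by [].
Qed.

Lemma realify_sum (m : M) (c : 'I_k -> R) :
  ev m (\sum_i c i *: iota (u i)) = \sum_i c i * (m (u i))%:~R.
Proof. by rewrite linear_sum; apply: eq_bigr => i _; rewrite realifyZ realifyE. Qed.

Lemma cone_coords_uniq sigma (c d : 'I_k -> R) : Sigma sigma ->
    (forall i, c i != 0 -> rho i `<=` sigma) ->
    (forall i, d i != 0 -> rho i `<=` sigma) ->
  \sum_i c i *: iota (u i) = \sum_i d i *: iota (u i) -> c =1 d.
Proof.
move=> sS cs ds eq_cd i.
have [rho_s|rhoN] := pselect (rho i `<=` sigma); last first.
  have [->|/cs//] := eqVneq (c i) 0.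
  by have [->|/ds//] := eqVneq (d i) 0.
have [m mE] := dual_gen sS rho_s.
suff evm (e : 'I_k -> R) : (forall i, e i != 0 -> rho i `<=` sigma) ->
    ev m (\sum_i e i *: iota (u i)) = e i by rewrite -[LHS]evm // eq_cd evm.
move=> es; rewrite realify_sum (bigD1 i) //= mE // eqxx mulr1 big1 ?addr0 // => j /negPf ji.
have [->|/es/mE->] := eqVneq (e j) 0; first by rewrite mul0r.
by rewrite ji mulr0.
Qed.

(** The support of [c] has to lie in a single cone: this is what singles out one among the
    expansions of [v] in the ray generators. *)
Definition is_coord (v : NR) (c : 'I_k -> R) :=
  [/\ forall i, 0 <= c i,
      exists2 sigma, Sigma sigma & forall i, c i != 0 -> rho i `<=` sigma &
      v = \sum_i c i *: iota (u i)].

(** Both expansions agree with one over [sigma] intersected with [tau], which is again a cone of the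
    fan. *)
Lemma is_coord_uniq v c d : is_coord v c -> is_coord v d -> c =1 d.
Proof.
move=> [c0 [sigma sS cs] vc] [d0 [tau tS dt] vd].
have sv : sigma v by apply/(mem_cone_rays v sS); exists c.
have tv : tau v by apply/(mem_cone_rays v tS); exists d.
have [_ _ faceS faceI] := hfan.
have stS : Sigma (sigma `&` tau) by apply: faceS sS (faceI _ _ sS tS).1.
have [e [e0 est ve]] := (mem_cone_rays v stS).1 (conj sv tv).
move=> i; transitivity (e i).
  apply: (cone_coords_uniq sS) => //; last by rewrite -vc.
  by move=> j /est; rewrite subsetI => -[].
apply: (cone_coords_uniq tS) => //; last by rewrite -vd.
by move=> j /est; rewrite subsetI => -[].
Qed.

Lemma is_coord_ex (v : supp) : exists c, is_coord (val v) c.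
Proof.
have [sigma sS sv] := set_valP v.
have [c [c0 cs vE]] := (mem_cone_rays (val v) sS).1 sv.
by exists c; split=> //; exists sigma.
Qed.

Definition coord (v : supp) : 'I_k -> R := sval (cid (is_coord_ex v)).

Lemma coordP v : is_coord (val v) (coord v).
Proof. exact: svalP (cid (is_coord_ex v)). Qed.

(** By uniqueness any expansion over [sigma] is the coordinate vector, so the support of the
    coordinates decides in which cones a point lies. *)
Lemma mem_coord sigma v : Sigma sigma ->
  sigma (val v) <-> forall i, coord v i != 0 -> rho i `<=` sigma.
Proof.
move=> sS; have [c0 _ vE] := coordP v.
split=> [sv|cs]; last by apply/mem_cone_rays => //; exists (coord v).
have [c [c'0 cs vc]] := (mem_cone_rays (val v) sS).1 sv.
have /(is_coord_uniq (coordP v)) cE : is_coord (val v) c by split=> //; exists sigma.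
by move=> i; rewrite cE; apply: cs.
Qed.

Lemma coord_surj sigma (c : 'I_k -> R) : Sigma sigma -> (forall i, 0 <= c i) ->
    (forall i, c i != 0 -> rho i `<=` sigma) ->
  exists2 v : supp, sigma (val v) & coord v =1 c.
Proof.
move=> sS c0 cs; pose x := \sum_i c i *: iota (u i).
have sx : sigma x by apply/mem_cone_rays => //; exists c.
have xsupp : fan_support Sigma x by exists sigma.
exists (exist _ x (mem_set xsupp)); first exact: sx.
by apply: is_coord_uniq (coordP _) _; split=> //; exists sigma.
Qed.

Lemma realify_coord (m : M) (v : supp) :
  ev m (val v) = \sum_i coord v i * (m (u i))%:~R.
Proof. by have [_ _ ->] := coordP v; rewrite realify_sum. Qed.

(** On a cone containing ray i the coordinate is the dual functional of [dual_gen]; on the other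
    cones it is zero. *)
Lemma coord_PL i : (fun v => coord v i) \in PL_pred (Sigma := Sigma).
Proof.
apply/asboolP => sigma sS.
have [/(dual_gen sS)[m mE]|rhoN] := pselect (rho i `<=` sigma).
  exists m => v /(mem_coord v sS) cs; rewrite realify_coord (bigD1 i) //=.
  have [ci|/cs/mE->] := eqVneq (coord v i) 0.
    rewrite ci mul0r add0r big1 // => j /negPf ji.
    have [->|/cs/mE->] := eqVneq (coord v j) 0; first by rewrite mul0r.
    by rewrite ji mulr0.
  rewrite eqxx mulr1 big1 ?addr0 // => j /negPf ji.
  have [->|/cs/mE->] := eqVneq (coord v j) 0; first by rewrite mul0r.
  by rewrite ji mulr0.
exists (\0 : M) => v /(mem_coord v sS) cs; rewrite realify0.
by have [//|/cs] := eqVneq (coord v i) 0.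
Qed.

Lemma ray_gen_mem i : rho i (iota (u i)).
Proof.
have [rhoS _ _] := hrho; have [sS _] := rhoS i Logic.I.
apply/(mem_cone_rays _ sS); exists (fun j => (j == i)%:R); split=> [j|j|].
- exact: ler0n.
- by have [->|_] := eqVneq j i => [_ ?|]; rewrite /= ?eqxx.
- rewrite (bigD1 i) //= eqxx scale1r big1 ?addr0 // => j /negPf->.
  by rewrite scale0r.
Qed.

(** Both generators are multiples of one vector, whereas a dual functional separates the generators
    of distinct rays inside a common cone. *)
Lemma ray_subset i j : rho i `<=` rho j -> i = j.
Proof.
have [rhoS rho_inj _] := hrho; have [sS dimj] := rhoS j Logic.I.
move=> ij; have [v [_ _ jv]] := dimj.
have [m mE] := dual_gen sS ij; have [m' m'E] := dual_gen sS (@subset_refl _ (rho j)).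
have [a ia] := jv _ (ij _ (ray_gen_mem i)).
have [b jb] := jv _ (ray_gen_mem j).
apply/eqP; apply: contraT => /negPf neq_ij.
have ev_a (l : M) : (l (u i))%:~R = a * ev l v by rewrite -(realifyE NR) ia realifyZ.
have ev_b (l : M) : (l (u j))%:~R = b * ev l v by rewrite -(realifyE NR) jb realifyZ.
have /eqP := ev_b m; rewrite mE // [j == i]eq_sym neq_ij eq_sym mulf_eq0 => /orP[/eqP b0|/eqP m0].
  by have /eqP := ev_b m'; rewrite m'E // eqxx b0 mul0r oner_eq0.
by have /eqP := ev_a m; rewrite mE // eqxx m0 mulr0 oner_eq0.
Qed.

(** The coordinate is itself a Courant function, so [xget] does not return its default; and a
    piecewise-linear function is determined on each cone by its values at the ray generators. *)
Lemma courantE i v : courant Sigma (rho i) v = coord v i.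
Proof.
have [rhoS rho_inj rho_surj] := hrho.
have ex_courant : is_courant (rho i) (MkPL (coord_PL i)).
  split=> [x xE|_ /rho_surj[j _ <-] neq_ji x jx] /=.
    have [iS _] := rhoS i Logic.I.
    rewrite (@is_coord_uniq _ _ (fun j => (j == i)%:R) (coordP x)) ?eqxx //.
    split=> [j||]; first exact: ler0n.
      exists (rho i) => [|j]; first exact: iS.
      by have [->|_] := eqVneq j i => [_ ?|]; rewrite /= ?eqxx.
    rewrite xE (bigD1 i) //= eqxx scale1r big1 ?addr0 // => j /negPf->.
    by rewrite scale0r.
  have [jS _] := rhoS j Logic.I.
  have [//|/((mem_coord x jS).1 jx)/ray_subset ij] := eqVneq (coord x i) 0.
  by case: neq_ji; rewrite ij.
have [d1 d0] : is_courant (rho i) (courant Sigma (rho i)).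
  exact: xgetPex (ex_intro _ _ ex_courant).
set d := courant _ _ in d1 d0 *.
have [c0 [sigma sS cs] vE] := coordP v.
have sv : sigma (val v) by apply/mem_coord.
have /asboolP/(_ _ sS)[m dm] := PL_mem d.
have m_u j : rho j `<=` sigma -> (m (u j))%:~R = (j == i)%:R :> R.
  move=> js; have jsupp : fan_support Sigma (iota (u j)).
    by exists sigma => //; apply/js/ray_gen_mem.
  pose x : supp := exist (fun y => is_true (y \in fan_support Sigma)) _ (mem_set jsupp).
  rewrite -(realifyE NR) -(dm x); last exact/js/ray_gen_mem.
  have [ji|ji] := eqVneq j i; first by rewrite d1 //= ji.
  rewrite (d0 (rho j)) //; first exact: rhoS.
    by move=> /rho_inj eq_ji; case/eqP: ji; apply: eq_ji; rewrite in_setT.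
  exact: ray_gen_mem.
rewrite (dm v sv) realify_coord (bigD1 i) //= big1 ?addr0 => [|j /negPf ji].
  have [->|/cs/m_u->] := eqVneq (coord v i) 0; first by rewrite mul0r.
  by rewrite eqxx mulr1.
have [->|/cs/m_u->] := eqVneq (coord v j) 0; first by rewrite mul0r.
by rewrite ji mulr0.
Qed.

(** * The presentation map *)

Lemma coord_inj (v w : supp) : coord v =1 coord w -> v = w.
Proof.
move=> eq_vw; apply: val_inj; have [_ _ ->] := coordP v; have [_ _ ->] := coordP w.
by apply: eq_bigr => i _; rewrite eq_vw.
Qed.

Local Notation Zx := (mpoly k int).
Local Notation SR := (stanley_reisner_ideal Sigma rho).
Local Notation J := (mult_linear_ideal rho).
Local Notation K := (sum_ideal SR J).
Local Notation eval := (@PE_eval R N NR Sigma).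

Definition pvar (i : 'I_k) : PE Sigma := 1 - exp_PL (courant Sigma (rho i)).

(* mmap is only available for nontrivial target rings, and PE may be zero. *)
Definition Phi (p : Zx) : PE Sigma :=
  \sum_(m <- msupp p) (mcoeff m p)%:~R * \prod_i pvar i ^+ m i.

Lemma eval_pvar v i : eval v (pvar i) = 1 - expR (coord v i).
Proof. by rewrite rmorphB rmorph1 -courantE. Qed.

Lemma eval_Phi v p : eval v (Phi p) = mmap intr (fun i => 1 - expR (coord v i)) p.
Proof.
rewrite rmorph_sum; apply: eq_bigr => m _; rewrite rmorphM rmorph_int rmorph_prod.
by congr (_ * _); apply: eq_bigr => i _; rewrite rmorphXn /= eval_pvar.
Qed.

Lemma Phi_zmod : zmod_morphism Phi.
Proof. by move=> p q; apply: PE_ext => v; rewrite rmorphB /= !eval_Phi mmapB. Qed.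

Lemma Phi_monoid : monoid_morphism Phi.
Proof.
split=> [|p q]; apply: PE_ext => v.
  by rewrite eval_Phi !rmorph1.
by rewrite rmorphM /= !eval_Phi rmorphM.
Qed.

HB.instance Definition _ := GRing.isZmodMorphism.Build Zx (PE Sigma) Phi Phi_zmod.
HB.instance Definition _ := GRing.isMonoidMorphism.Build Zx (PE Sigma) Phi Phi_monoid.

Lemma eval_Phi_xvar v i : eval v (Phi (xvar i)) = 1 - expR (coord v i).
Proof. by rewrite eval_Phi /xvar mmapX mmap1U. Qed.

Lemma Phi_xvar i : Phi (xvar i) = pvar i.
Proof. by apply: PE_ext => v; rewrite eval_Phi_xvar eval_pvar. Qed.

Lemma eval_Phi_1xvar v i : eval v (Phi (1 - xvar i)) = expR (coord v i).
Proof. by rewrite rmorphB rmorph1 rmorphB rmorph1 /= eval_Phi_xvar opprB addrC subrK. Qed.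

(** At any point, some variable of a generator belongs to a ray outside the cone of that point;
    there the coordinate is 0 and the factor is 1 - e^0 = 0. *)
Lemma Phi_SR : SR `<=` ker_ideal Phi.
Proof.
apply: span_ideal_sub => _ [s /= sN <-]; apply: PE_ext => v.
have [_ [sigma sS cs] _] := coordP v.
have [i [is_ rhoN]] : exists i, i \in s /\ ~ rho i `<=` sigma.
  apply: contrapT => /forallNP iN; apply: sN; exists sigma => // i is_.
  by apply: contrapT => rhoN; apply: (iN i).
have ci : coord v i = 0 by apply/eqP; apply: contrapT => /negP/cs.
rewrite !rmorph_prod rmorph0; apply/eqP; rewrite prodf_seq_eq0; apply/hasP.
by exists i => //=; rewrite eval_Phi_xvar ci expR0 subrr.
Qed.

Lemma mpolyX_SR (m : multinom k) :
    ~ (exists2 sigma, Sigma sigma & forall i, m i != 0%N -> rho i `<=` sigma) ->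
  ideal_set SR (mpolyX int m).
Proof.
move=> mN; pose s := [seq i <- enum 'I_k | m i != 0%N].
(* Split off one copy of each variable that occurs; the predecessor leaves exponent 0 at the
   variables that do not. *)
have -> : mpolyX int m = (\prod_i xvar i ^+ (m i).-1) * \prod_(i <- s) xvar i.
  rewrite mpolyXE_id big_filter big_enum_cond /= [X in _ * X]big_mkcond -big_split /=.
  by apply: eq_bigr => i _; case: (m i) => [|n] /=; rewrite ?mulr1 // exprSr.
apply: idealM; exists [:: (1, \prod_(i <- s) xvar i)].
rewrite big_seq1 mul1r; split=> // ag; rewrite inE => /eqP-> /=.
exists s => //= -[sigma sS ss]; apply: mN; exists sigma => // i mi.
by apply: ss; rewrite mem_filter mi mem_enum.
Qed.

(* The monomials of p supported on the rays of a cone sigma are read off the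
   values of Phi p on sigma, where the other variables vanish. *)
Lemma Phi_ker p : Phi p = 0 <-> ideal_set SR p.
Proof.
split=> [p0|/Phi_SR//].
suff suppN m : m \in msupp p ->
    ~ exists2 sigma, Sigma sigma & forall i, m i != 0%N -> rho i `<=` sigma.
  rewrite [p]mpolyE big_seq; elim/big_ind: _ => [|x y|m /suppN/mpolyX_SR Sm].
  - exact: ideal0.
  - exact: idealD.
  - by rewrite -mul_mpolyC; apply: idealM.
move=> mp [sigma sS ms].
pose on (m : multinom k) := [forall i, (m i != 0%N) ==> `[< rho i `<=` sigma >]].
pose q := \sum_(m <- msupp p | on m) (mcoeff m p) *: mpolyX int m.
have q0 : q = 0.
  apply: (@mpoly_vanish_npos R) => x x0.
  (* Since x_i = 1 - e^(c_i), every nonpositive x_i is reached by a coordinate c_i >= 0, that is, by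
     a point of [sigma]. *)
  pose c i := if `[< rho i `<=` sigma >] then ln (1 - x i) else 0.
  have x1 i : 1 <= 1 - x i by rewrite lerBrDr gerDl.
  have c0 i : 0 <= c i by rewrite /c; case: ifP => // _; exact: ln_ge0.
  have cs i : c i != 0 -> rho i `<=` sigma.
    by rewrite /c; case: asboolP => // _; rewrite eqxx.
  have [v _ vc] := coord_surj sS c0 cs.
  rewrite -(rmorph0 (eval v)) -p0 /= eval_Phi /q raddf_sum /= [RHS](bigID on) /=.
  rewrite [X in _ + X]big1 ?addr0 => [|m' /forallPn[i]]; last first.
    rewrite negb_imply => /andP[mi /negPf rhoN].
    by rewrite /mmap1 (bigD1 i) //= vc /c rhoN expR0 subrr expr0n (negPf mi) mul0r mulr0.
  apply: eq_bigr => m' /forallP m's; rewrite mmapZ mmapX; congr (_ * _).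
  apply: eq_bigr => i _; have [->|mi] := eqVneq (m' i) 0%N; first by rewrite !expr0.
  have := m's i; rewrite mi /= vc /c => ->; rewrite lnK ?subKr // posrE.
  by apply: lt_le_trans (x1 i).
have om : on m by apply/forallP => i; apply/implyP => /ms/asboolP.
have : mcoeff m q = 0 by rewrite q0 mcoeff0.
rewrite /q raddf_sum big_mkcond (bigD1_seq m) ?msupp_uniq //= om mcoeffZ mcoeffX eqxx mulr1.
rewrite big1 ?addr0 => [/eqP|m' m'm]; first by rewrite mcoeff_eq0 mp.
by case: (on m') => //; rewrite mcoeffZ mcoeffX (negPf m'm) mulr0.
Qed.

(** Exponents are split by sign because a polynomial in the 1 - x_i only allows nonnegative powers.
    For [e i] = <m, u_i> the two parts are the two terms of the generator of J at m. *)
Definition pos_part (e : 'I_k -> int) : Zx := \prod_(i < k | 0 < e i) (1 - xvar i) ^+ `|e i|%N.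
Definition neg_part (e : 'I_k -> int) : Zx := \prod_(i < k | e i < 0) (1 - xvar i) ^+ `|e i|%N.

Definition comb (e : 'I_k -> int) : PL Sigma := \sum_i MkPL (coord_PL i) *~ e i.

Lemma combE e v : comb e v = \sum_i coord v i * (e i)%:~R.
Proof.
rewrite -[LHS]/(PL_eval v (comb e)) raddf_sum; apply: eq_bigr => i _.
by rewrite raddfMz /= -mulrzr.
Qed.

(** As 1 - x_i maps to e^(delta_i), this compares powers of exponentials factor by factor; negative
    exponents are moved to the other side. *)
Lemma exp_comb e : Phi (pos_part e) = exp_PL (comb e) * Phi (neg_part e).
Proof.
apply: PE_ext => v; rewrite rmorphM /=.
have -> : eval v (exp_PL (comb e)) = \prod_i expR (coord v i * (e i)%:~R).
  by rewrite -expR_sum -combE.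
rewrite !rmorph_prod [LHS]big_mkcond [X in _ * X]big_mkcond -big_split /=.
apply: eq_bigr => i _; rewrite !rmorphXn /= eval_Phi_1xvar.
case: (e i) => [[|n]|n] /=.
- by rewrite mulr0 expR0 mulr1.
- by rewrite mulr1 -expRM_natr.
- by rewrite NegzE intrN mulrN -expRM_natr expRN mulVf // expR_eq0.
Qed.

Lemma exp_linear (l : PL Sigma) (m : M) : (forall v, l v = ev m (val v)) ->
  Phi (pos_part (fun i => m (u i))) = exp_PL l * Phi (neg_part (fun i => m (u i))).
Proof.
move=> lm; rewrite exp_comb; congr (_ * _); apply: PE_ext => v.
by rewrite /PE_eval /= combE lm realify_coord.
Qed.

Lemma linear_PL (m : M) : exists l : PL Sigma, forall v, l v = ev m (val v).
Proof. by exists (comb (fun i => m (u i))) => v; rewrite combE realify_coord. Qed.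

(** * Denominators that are units modulo I + J *)

Definition invertible (d : Zx) := exists z, quot_proj K d * z = 1.

Lemma invertible1 : invertible 1.
Proof. by exists 1; rewrite rmorph1 mulr1. Qed.

Lemma invertibleM d d' : invertible d -> invertible d' -> invertible (d * d').
Proof.
by move=> [z dz] [z' dz']; exists (z * z'); rewrite rmorphM mulrACA dz dz' mulr1.
Qed.

Lemma SR_sub_K x : ideal_set SR x -> ideal_set K x.
Proof. by move=> Sx; exists x => //; exists 0; [exact: ideal0|rewrite addr0]. Qed.

Lemma J_sub_K x : ideal_set J x -> ideal_set K x.
Proof. by move=> Jx; exists 0; [exact: ideal0|exists x => //; rewrite add0r]. Qed.

Lemma J_gen (m : M) :
  ideal_set J (pos_part (fun i => m (u i)) - neg_part (fun i => m (u i))).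
Proof.
exists [:: (1, pos_part (fun i => m (u i)) - neg_part (fun i => m (u i)))].
rewrite big_seq1 mul1r; split=> // ag; rewrite inE => /eqP-> /=.
by exists m.
Qed.

(** Modulo I + J the x_i satisfy the hypotheses of [nilpotent_face_ring], the faces being sets of
    rays in a common cone; the relation at i comes from the m dual to u_i on that cone. *)
Lemma invertible_1xvar i : invertible (1 - xvar i).
Proof.
rewrite /invertible rmorphB rmorph1; apply: is_nilpotentB1_unit; move: i.
apply: (@nilpotent_face_ring _ _ _ (fun S : {set 'I_k} =>
  exists2 sigma, Sigma sigma & forall i, i \in S -> rho i `<=` sigma)).
  move=> S SN; rewrite -rmorph_prod; apply/quot_proj_eq0/SR_sub_K.
  exists [:: (1, \prod_(i <- enum S) xvar i)].
  rewrite big_seq1 mul1r big_enum; split=> // ag; rewrite inE => /eqP-> /=.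
  exists (enum S) => /=; last by rewrite big_enum.
  move=> [sigma sS Ss]; apply: SN; exists sigma => // i iS.
  by apply: Ss; rewrite mem_enum.
move=> S i [sigma sS Ss] iS; have [m mE] := dual_gen sS (Ss i iS).
exists (fun j => m (u j)); split=> [|j /Ss/mE-> /negPf->//|].
  by rewrite mE ?eqxx //; apply: Ss.
have /J_sub_K/quot_proj_eq0 := J_gen m.
rewrite rmorphB /= => /eqP; rewrite subr_eq0 => /eqP.
rewrite !rmorph_prod; under eq_bigr do rewrite rmorphXn rmorphB rmorph1.
by under [X in _ = X -> _]eq_bigr do rewrite rmorphXn rmorphB rmorph1.
Qed.

Lemma invertible_neg_part e : invertible (neg_part e).
Proof.
rewrite /neg_part; elim/big_ind: _ => [|x y|i _].
- exact: invertible1.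
- exact: invertibleM.
- elim: `|e i|%N => [|n IHn]; first exact: invertible1.
  by rewrite exprS; exact: invertibleM (invertible_1xvar i) IHn.
Qed.

(** The denominator only has to be invertible modulo I + J, which suffices to make its image in
    [uPE] a unit. *)
Definition fraction (F : PE Sigma) := exists d q, invertible d /\ F * Phi d = Phi q.

Lemma fraction0 : fraction 0.
Proof. by exists 1, 0; split; [exact: invertible1|rewrite mul0r rmorph0]. Qed.

Lemma fractionD F G : fraction F -> fraction G -> fraction (F + G).
Proof.
move=> [d [q [di dF]]] [e [r [ei eG]]]; exists (d * e), (q * e + r * d).
split; first exact: invertibleM.
by rewrite rmorphD !rmorphM /= -dF -eG; ring.
Qed.

Lemma fractionMz F a : fraction F -> fraction (F *~ a).
Proof.
move=> [d [q [di dF]]]; exists d, (q *~ a); split=> //.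
by rewrite rmorphMz /= -dF mulrzAl.
Qed.

(* F composed with the retraction of the fan onto sigma that forgets the
   coordinates along the rays outside sigma. *)
Lemma retract_PE (F : PE Sigma) sigma : Sigma sigma -> exists2 G, fraction G &
  forall v, exists w, (forall i, coord w i =
    if `[< rho i `<=` sigma >] then coord v i else 0) /\ G v = F w.
Proof.
move=> sS; have /asboolP/(_ _ sS)[s Fs] := PE_mem F.
(* Keeping <m, u_i> on the rays of [sigma] and 0 elsewhere makes [comb (e m)] the pullback of m
   along the retraction. *)
pose e (m : M) i := if `[< rho i `<=` sigma >] then m (u i) else 0.
exists (\sum_(am <- s) exp_PL (comb (e am.2)) *~ am.1).
  elim/big_ind: _ => [|x y|am _]; [exact: fraction0|exact: fractionD|].
  apply: fractionMz; exists (neg_part (e am.2)), (pos_part (e am.2)).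
  by split; [exact: invertible_neg_part|rewrite exp_comb].
move=> v; pose c i := if `[< rho i `<=` sigma >] then coord v i else 0.
have [v0 _ _] := coordP v.
have c0 i : 0 <= c i by rewrite /c; case: ifP.
have cs i : c i != 0 -> rho i `<=` sigma.
  by rewrite /c; case: asboolP => // _; rewrite eqxx.
have [w sw wc] := coord_surj sS c0 cs; exists w; split=> //.
rewrite (Fs w sw) -[LHS]/(eval v _) raddf_sum; apply: eq_bigr => am _.
rewrite raddfMz -mulrzl; congr (_ * expR _).
rewrite combE realify_coord; apply: eq_bigr => i _.
by rewrite wc /c /e; case: asboolP => // _; rewrite mulr0 mul0r.
Qed.

(* Subtracting from G its retraction onto sigma makes it vanish on sigma and
   preserves its vanishing on the other cones. *)
Lemma PE_fraction (F : PE Sigma) : fraction F.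
Proof.
have [/finite_seqP[s sE] _ _ _] := hfan.
(* Induction on the list of cones: [G] is the remainder of [F] after subtracting fractions, and once
   all cones are treated it is 0. *)
suff [G [fG G0]] : exists G, fraction (F - G) /\
    forall sigma, sigma \in s -> forall v, sigma (val v) -> G v = 0.
  have -> : F = F - G; last by [].
  rewrite (_ : G = 0) ?subr0 //; apply: PE_ext => v; rewrite rmorph0.
  have [sigma sS sv] := set_valP v; apply: (G0 sigma) => //.
  by move: sS; rewrite sE.
have : {subset s <= [pred sigma | `[< Sigma sigma >]]}.
  by move=> sigma ss; apply/asboolP; rewrite sE.
elim: s {sE} => [_|sigma s IHs sS]; first by exists F; rewrite subrr; split=> //; exact: fraction0.
have [tau ts|G [fG G0]] := IHs; first by apply: sS; rewrite inE ts orbT.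
have /asboolP Ssigma : `[< Sigma sigma >] by apply: (sS sigma); rewrite inE eqxx.
have [H fH HE] := retract_PE G Ssigma.
exists (G - H); split.
  by rewrite opprB addrCA; apply: fractionD.
move=> tau; rewrite inE => /orP[/eqP->|ts] v tv; rewrite -[LHS]/(G v - H v).
  have [w [wE ->]] := HE v; rewrite (_ : w = v) ?subrr //; apply: coord_inj => i.
  rewrite wE; case: asboolP => // rhoN.
  by have [->|/((mem_coord v Ssigma).1 tv)] := eqVneq (coord v i) 0.
(* Forgetting coordinates keeps a point of [tau] in [tau], so [G] vanishes at [v] and at [w]. *)
have [w [wE ->]] := HE v; rewrite (G0 tau) // (G0 tau) ?subrr //.
have Stau : Sigma tau by apply/asboolP; apply: (sS tau); rewrite inE ts orbT.
apply/(mem_coord w Stau) => i; rewrite wE; case: asboolP => [_|]; last by rewrite eqxx.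
exact: (mem_coord v Stau).1.
Qed.

(** The fractions with numerator in J. They form an ideal of [PE], since every element of [PE] is
    itself a fraction. *)
Definition J_fraction : set (PE Sigma) :=
  [set X | exists d q, [/\ invertible d, ideal_set J q & X * Phi d = Phi q]].

Lemma J_fraction0 : J_fraction 0.
Proof.
by exists 1, 0; split; [exact: invertible1|exact: ideal0|rewrite mul0r rmorph0].
Qed.

Lemma J_fractionD X Y : J_fraction X -> J_fraction Y -> J_fraction (X + Y).
Proof.
move=> [d [q [di Jq dX]]] [e [r [ei Jr eY]]]; exists (d * e), (e * q + d * r); split.
- exact: invertibleM.
- by apply: idealD; apply: idealM.
- by rewrite rmorphD !rmorphM /= -dX -eY; ring.
Qed.

Lemma J_fractionM F X : J_fraction X -> J_fraction (F * X).
Proof.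
move=> [d [q [di Jq dX]]]; have [e [r [ei eF]]] := PE_fraction F.
exists (e * d), (r * q); split; [exact: invertibleM|exact: idealM|].
by rewrite !rmorphM /= -dX -eF; ring.
Qed.

(** It suffices to treat e^l - 1: multiplied by the image of the negative part it becomes the image
    of a generator of J. *)
Lemma linear_ideal_fraction : linear_ideal Sigma `<=` J_fraction.
Proof.
apply: (@span_ideal_sub _ _ (Ideal J_fraction0 J_fractionD J_fractionM)).
move=> _ [l [m lm] <-] /=.
exists (neg_part (fun i => m (u i))).
exists (pos_part (fun i => m (u i)) - neg_part (fun i => m (u i))).
split; [exact: invertible_neg_part|exact: J_gen|].
by rewrite rmorphB /= (exp_linear lm) mulrBl mul1r.
Qed.

(** * Kernel and surjectivity of the induced map *)

Definition uPhi : {rmorphism Zx -> uPE Sigma} := quot_proj (linear_ideal Sigma) \o Phi.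

Lemma uPhi_J : J `<=` ker_ideal uPhi.
Proof.
apply: span_ideal_sub => _ [m _ <-]; have [l lm] := linear_PL m.
pose e i := m (u i).
suff : ideal_set (linear_ideal Sigma) (Phi (pos_part e - neg_part e)).
  by move/quot_proj_eq0.
have -> : Phi (pos_part e - neg_part e) = Phi (neg_part e) * (exp_PL l - 1).
  by rewrite rmorphB /= (exp_linear lm) mulrBr mulr1 mulrC.
apply: idealM; exists [:: (1, exp_PL l - 1)]; rewrite big_seq1 mul1r; split=> // ag.
by rewrite inE => /eqP->; exists l => //; exists m.
Qed.

(** If the image of p is 0, then [Phi (p * d) = Phi q] with q in J and d a unit modulo I + J. By
    [Phi_ker], p d - q lies in I, so p d lies in I + J, and cancelling d puts p there too. *)
Lemma uPhi_ker p : uPhi p = 0 <-> ideal_set K p.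
Proof.
split=> [/quot_proj_eq0/linear_ideal_fraction[d [q [[z dz] Jq pd]]]|]; last first.
  move=> [a Sa [b Jb <-]]; rewrite rmorphD (uPhi_J Jb) addr0.
  by rewrite /= (Phi_SR Sa) rmorph0.
apply/quot_proj_eq0; rewrite -[LHS]mulr1 -dz mulrA -rmorphM /=.
suff /quot_proj_eq0-> : ideal_set K (p * d) by rewrite mul0r.
exists (p * d - q); first by apply/Phi_ker; rewrite rmorphB rmorphM /= pd subrr.
by exists q => //; rewrite subrK.
Qed.

Lemma uPhi_surj a : exists p, uPhi p = a.
Proof.
have [F ->] : exists F, a = quot_proj (linear_ideal Sigma) F.
  by exists (repr a); rewrite /quot_proj reprK.
have [d [q [[z dz] Fd]]] := PE_fraction F.
(* A polynomial inverse of [d] modulo I + J; since I + J maps to 0, it also inverts [uPhi d], and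
   [q * z'] is the preimage. *)
pose z' : Zx := repr z.
have /(congr1 (fun x => x - 1)) : quot_proj K (d * z') = 1.
  by rewrite rmorphM /= /z' {2}/quot_proj reprK.
rewrite subrr -(rmorph1 (quot_proj K)) -rmorphB => /quot_proj_eq0/uPhi_ker.
rewrite rmorphB rmorphM rmorph1 => /eqP; rewrite subr_eq0 => /eqP dz1.
exists (q * z'); rewrite rmorphM [X in X * _]/= -Fd rmorphM -mulrA.
by rewrite -[X in _ * (X * _)]/(uPhi d) dz1 mulr1.
Qed.

Lemma uPhi_xvar i : uPhi (xvar i) = 1 - uPE_class (exp_PL (courant Sigma (rho i))).
Proof. by rewrite /= Phi_xvar rmorphB rmorph1. Qed.

End UnimodularFan.

Theorem theorem2 (R : realType) (N : zmodType) (hN : fg_free N)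
    (NR : realification R N) (Sigma : set (set NR))
    (hfan : is_fan Sigma) (huni : unimodular Sigma)
    (k : nat) (rho : 'I_k -> set NR)
    (hrho : set_bij [set: 'I_k] (rays Sigma) rho) :
  exists phi : {rmorphism mpoly k int -> uPE Sigma},
    (forall i, phi (xvar i) = 1 - uPE_class (exp_PL (courant Sigma (rho i)))) /\
    exists psi : {rmorphism
        quot_ring (sum_ideal (stanley_reisner_ideal Sigma rho)
                             (mult_linear_ideal rho)) -> uPE Sigma},
      bijective psi /\ forall p, psi (quot_proj _ p) = phi p.
Proof.
exists (uPhi hfan huni hrho); split; first exact: uPhi_xvar.
exact: quot_ring_iso (uPhi_ker hfan huni hrho) (uPhi_surj hfan huni hrho).
Qed.
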